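(* Assume that $\inf_{x\in\mathbb{R}^n}h(x)<0<\sup_{x\in\mathbb{R}^n}h(x)$, and that there exists $\zeta\in\{x\in\mathbb{R}^n: h(x)=0\}$ such that for all $x\in\mathbb{R}^n$, $x^TBx=0$ implies $(B\zeta+d)^Tx=0$. Then for each given $\lambda\in\mathbb{R}$ the following two statements are equivalent: (i) The system $f_1(x)-\lambda f_2(x)<0$, $h(x)=0$ has no solution $x\in\mathbb{R}^n$. (ii) There exists $\mu\in\mathbb{R}$ such that $f_1(x)-\lambda f_2(x)+\mu h(x)\ge 0$ for all $x\in\mathbb{R}^n$.
   Context: For $i=1,2$ let $f_i(x)=x^TA_ix+2b_i^Tx+c_i$ and let $h(x)=x^TBx+2d^Tx$ be functions on $\mathbb{R}^n$, where $A_1,A_2,B$ are real symmetric $n\times n$ matrices (possibly indefinite), $b_1,b_2,d\in\mathbb{R}^n$ and $c_1,c_2\in\mathbb{R}$. *)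

(* Defs.v *)
From HB Require Import structures.
From mathcomp Require Import all_boot all_order all_algebra.
From mathcomp Require Import all_classical all_reals all_analysis.
Set Implicit Arguments.
Unset Strict Implicit.
Unset Printing Implicit Defensive.
Import Order.TTheory GRing.Theory Num.Theory.
Local Open Scope ring_scope.

(* The [0 0] entry turns the 1 x 1 matrix product into a scalar. *)
Definition dotp (R : realType) (n : nat) (u v : 'cV[R]_n) : R :=
  (u^T *m v) 0 0.

Definition qform (R : realType) (n : nat) (A : 'M[R]_n) (x : 'cV[R]_n) : R :=
  (x^T *m A *m x) 0 0.

Definition quadfun (R : realType) (n : nat)
    (A : 'M[R]_n) (b : 'cV[R]_n) (c : R) (x : 'cV[R]_n) : R :=
  qform A x + 2 * dotp b x + c.

Definition quadfun0 (R : realType) (n : nat)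
    (B : 'M[R]_n) (d : 'cV[R]_n) (x : 'cV[R]_n) : R :=
  qform B x + 2 * dotp d x.

(* Main.v *)
(** Homogenise: put F(x, t) = t^2 f(x / t) and H(x, t) = t^2 h(x / t), where
    f = f1 - lambda f2.  If f >= 0 on h = 0, then F >= 0 on H = 0: for t <> 0 by
    scaling, and for t = 0 because x^T B x = 0 makes h vanish on the whole line
    zeta + s x, so that f >= 0 on that line and its leading coefficient x^T A x
    is nonnegative. As H is indefinite, Finsler's lemma yields mu with
    F + mu H >= 0, and t = 1 gives the claim. *)
Require Import Defs.
From HB Require Import structures.
From mathcomp Require Import all_boot all_order all_algebra.
From mathcomp Require Import all_classical all_reals all_analysis.
From mathcomp Require Import ring lra.
Set Implicit Arguments.
Unset Strict Implicit.
Unset Printing Implicit Defensive.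
Import Order.TTheory GRing.Theory Num.Theory.
Local Open Scope classical_set_scope.
Local Open Scope ring_scope.

(** Since [a * c < 0], the discriminant exceeds [b ^+ 2], so the two real roots straddle 0;
    [a = c * (s * t)] is Vieta's formula. *)
Lemma quadratic_opposite_roots (R : rcfType) (a b c : R) :
  0 < a -> c < 0 ->
  exists s t : R, [/\ s < 0 < t, a = c * (s * t),
    a + s * b + s ^+ 2 * c = 0 & a + t * b + t ^+ 2 * c = 0].
Proof.
move=> a0 c0; pose r := Num.sqrt (b ^+ 2 - 4 * (a * c)).
have ac0 : a * c < 0 by rewrite pmulr_rlt0.
have r2 : r ^+ 2 = b ^+ 2 - 4 * (a * c) by rewrite sqr_sqrtr //; nra.
have /ltr_normlP[br1 br2] : `|b| < r.
  rewrite -(@ltr_pXn2r _ 2) ?nnegrE ?sqrtr_ge0 //.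
  by rewrite real_normK ?num_real // r2; lra.
have cn0 : c != 0 by rewrite lt_eqF.
exists ((r - b) / (2 * c)), ((- r - b) / (2 * c)); split.
- apply/andP; split.
  + by rewrite pmulr_rlt0 ?invr_lt0; lra.
  + by rewrite nmulr_rgt0 ?invr_lt0; lra.
(* Eliminating [a] in favour of [r] turns each remaining goal into a rational identity in [b], [c]
   and [r]. *)
- have -> : a = (b ^+ 2 - r ^+ 2) / (4 * c) by rewrite r2; field.
  by field.
- have -> : a = (b ^+ 2 - r ^+ 2) / (4 * c) by rewrite r2; field.
  by field.
- have -> : a = (b ^+ 2 - r ^+ 2) / (4 * c) by rewrite r2; field.
  by field.
Qed.

Lemma quadratic_ge0_lead (R : realFieldType) (a b c : R) :
  (forall s, 0 <= a + s * b + s ^+ 2 * c) -> 0 <= c.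
Proof.
move=> ge0; rewrite leNgt; apply/negP => c0.
(* Adding the values at [s] and [- s] cancels [b]. As [s >= 1], [s ^+ 2 * - c] is at least
   [s * - c], which exceeds [a]. *)
pose s := 1 + `|a| / - c.
have as0 : 0 <= `|a| / - c by rewrite divr_ge0 ?normr_ge0 //; lra.
have sc : s * - c = `|a| - c by rewrite /s; field; lra.
have := ge0 s; have := ge0 (- s); have := ler_norm a.
have : s * - c <= s ^+ 2 * - c by rewrite ler_wpM2r ?expr2 /s; nra.
by rewrite sc sqrrN mulNr; nra.
Qed.

(** Describing a form by its restrictions to lines avoids block matrices on the homogenised space;
    [P] plays the part of twice the polar form. *)
Definition is_quadratic (R : realType) (V : lmodType R) (F : V -> R) : Prop :=
  exists P : V -> V -> R,
    forall s z w, F (z + s *: w) = F z + s * P z w + s ^+ 2 * F w.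

(* The line through [z] and [w] meets [H = 0] at parameters [s < 0 < t] with
   [s * t = H z / H w]; averaging [F >= 0] over both points with weights [t]
   and [- s] cancels the cross term. *)
Lemma finsler_cross (R : realType) (V : lmodType R) (F H : V -> R) (z w : V) :
  is_quadratic F -> is_quadratic H ->
  (forall v, H v = 0 -> 0 <= F v) -> 0 < H z -> H w < 0 ->
  F z * H w <= F w * H z.
Proof.
move=> [P FP] [Q HQ] F0 Hz Hw.
have [s [t [/andP[s0 t0] Hst Hs Ht]]] := quadratic_opposite_roots (Q z w) Hz Hw.
have Fs : 0 <= F z + s * P z w + s ^+ 2 * F w by rewrite -FP F0 // HQ.
have Ft : 0 <= F z + t * P z w + t ^+ 2 * F w by rewrite -FP F0 // HQ.
have : 0 <= (t - s) * (F z - s * t * F w).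
  have -> : (t - s) * (F z - s * t * F w) =
    t * (F z + s * P z w + s ^+ 2 * F w) + - s * (F z + t * P z w + t ^+ 2 * F w).
    by ring.
  by rewrite addr_ge0 // mulr_ge0 //; lra.
rewrite pmulr_rge0 ?subr_gt0 ?(lt_trans s0) // => Fst.
have -> : F w * H z = F z * H w - H w * (F z - s * t * F w) by rewrite {1}Hst; ring.
by rewrite lerDl oppr_ge0 mulr_le0_ge0 // ltW.
Qed.

(** The goal asks that [mu >= - (F v / H v)] where [H v > 0] and [mu <= - (F v / H v)] where
    [H v < 0]. By [finsler_cross] every such lower bound is below every upper bound, so the supremum
    of the lower bounds serves as [mu]. *)
Lemma finsler (R : realType) (V : lmodType R) (F H : V -> R) :
  is_quadratic F -> is_quadratic H ->
  (forall v, H v = 0 -> 0 <= F v) ->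
  (exists z, 0 < H z) -> (exists w, H w < 0) ->
  exists mu, forall v, 0 <= F v + mu * H v.
Proof.
move=> qF qH F0 [z0 Hz0] [w0 Hw0].
pose S := [set - (F z / H z) | z in [set z | 0 < H z]].
have S0 : S !=set0 by exists (- (F z0 / H z0)), z0.
have Sub w : H w < 0 -> ubound S (- (F w / H w)).
  move=> Hw _ [z /= Hz <-].
  rewrite lerN2 ler_ndivrMr // mulrAC ler_pdivrMr //.
  exact: finsler_cross.
exists (sup S) => v; have [Hv|Hv|Hv] := ltgtP (H v) 0.
- have := ge_sup S0 (Sub _ Hv).
  by rewrite -mulNr ler_ndivlMr // -subr_ge0 opprK addrC.
- have /ub_le_sup : has_ubound S by exists (- (F w0 / H w0)); exact: Sub.
  move=> /(_ (- (F v / H v))) H1.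
  have : - (F v / H v) <= sup S by apply: H1; exists v.
  by rewrite -mulNr ler_pdivrMr // -subr_ge0 opprK addrC.
- by rewrite Hv mulr0 addr0 F0.
Qed.

Lemma dotpC (R : realType) (n : nat) (u v : 'cV[R]_n) : dotp u v = dotp v u.
Proof. by rewrite /dotp -[in RHS](trmxK u) -trmx_mul [RHS]mxE. Qed.

Lemma dotpDr (R : realType) (n : nat) (u v w : 'cV[R]_n) :
  dotp u (v + w) = dotp u v + dotp u w.
Proof. by rewrite /dotp mulmxDr mxE. Qed.

Lemma dotpZr (R : realType) (n : nat) (u v : 'cV[R]_n) (s : R) :
  dotp u (s *: v) = s * dotp u v.
Proof. by rewrite /dotp -scalemxAr mxE. Qed.

Lemma qformE (R : realType) (n : nat) (A : 'M[R]_n) (x : 'cV[R]_n) :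
  qform A x = dotp x (A *m x).
Proof. by rewrite /qform /dotp mulmxA. Qed.

Lemma qformZ (R : realType) (n : nat) (A : 'M[R]_n) (x : 'cV[R]_n) (s : R) :
  qform A (s *: x) = s ^+ 2 * qform A x.
Proof. by rewrite !qformE -scalemxAr dotpZr dotpC dotpZr dotpC expr2 mulrA. Qed.

Lemma qformD (R : realType) (n : nat) (A : 'M[R]_n) (x y : 'cV[R]_n) :
  A^T = A -> qform A (x + y) = qform A x + 2 * dotp (A *m x) y + qform A y.
Proof.
move=> symA; rewrite !qformE mulmxDr dotpDr !(dotpC (x + y)) !dotpDr.
rewrite (dotpC (A *m y) x) (dotpC (A *m y) y) (dotpC (A *m x) x).
have -> : dotp x (A *m y) = dotp (A *m x) y by rewrite /dotp trmx_mul symA mulmxA.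
ring.
Qed.

(** [R^o] is [R] as a module over itself, which makes the pairs a module to which [finsler]
    applies. *)
Definition homog (R : realType) (n : nat) (A : 'M[R]_n) (b : 'cV[R]_n) (c : R)
    (z : 'cV[R]_n * R^o) : R :=
  qform A z.1 + 2 * (z.2 * dotp b z.1) + c * z.2 ^+ 2.

Lemma homog_quadratic (R : realType) (n : nat) (A : 'M[R]_n) (b : 'cV[R]_n)
    (c : R) : A^T = A -> is_quadratic (homog A b c).
Proof.
move=> symA.
exists (fun z w => 2 * (dotp (A *m z.1) w.1 + z.2 * dotp b w.1
                        + w.2 * dotp b z.1 + c * (z.2 * w.2))).
move=> s [x t] [y u]; rewrite /homog /= qformD // qformZ !dotpDr !dotpZr.
rewrite /GRing.scale /=; ring.
Qed.

Lemma homog1 (R : realType) (n : nat) (A : 'M[R]_n) (b : 'cV[R]_n) (c : R)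
    (x : 'cV[R]_n) : homog A b c (x, 1) = quadfun A b c x.
Proof. by rewrite /homog /quadfun /= mul1r expr1n mulr1. Qed.

Lemma homog_scale (R : realType) (n : nat) (A : 'M[R]_n) (b : 'cV[R]_n) (c : R)
    (x : 'cV[R]_n) (t : R) :
  t != 0 -> homog A b c (x, t) = t ^+ 2 * quadfun A b c (t^-1 *: x).
Proof. by move=> t0; rewrite /homog /quadfun /= qformZ dotpZr; field. Qed.

Lemma quadfun_line (R : realType) (n : nat) (A : 'M[R]_n) (b : 'cV[R]_n) (c : R)
    (x y : 'cV[R]_n) (s : R) :
  A^T = A -> quadfun A b c (x + s *: y) =
    quadfun A b c x + s * (2 * dotp (A *m x + b) y) + s ^+ 2 * qform A y.
Proof.
move=> symA; rewrite /quadfun qformD // qformZ !dotpDr !dotpZr.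
by rewrite (dotpC (_ + b)) dotpDr (dotpC y b) (dotpC y (A *m x)); ring.
Qed.

Lemma quadfunB (R : realType) (n : nat) (A1 A2 : 'M[R]_n)
    (b1 b2 : 'cV[R]_n) (c1 c2 k : R) (x : 'cV[R]_n) :
  quadfun A1 b1 c1 x - k * quadfun A2 b2 c2 x =
    quadfun (A1 - k *: A2) (b1 - k *: b2) (c1 - k * c2) x.
Proof.
rewrite /quadfun !qformE mulmxBl -scalemxAl !(dotpC (b1 - _))
  -(scaleNr k b2) -(scaleNr k (A2 *m x)).
by rewrite !dotpDr !dotpZr !(dotpC x b1) !(dotpC x b2); ring.
Qed.

Lemma quadfun0E (R : realType) (n : nat) (B : 'M[R]_n) (d x : 'cV[R]_n) :
  quadfun0 B d x = quadfun B d 0 x.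
Proof. by rewrite /quadfun addr0. Qed.

Theorem theorem2p4 (R : realType) (n : nat)
    (A1 A2 B : 'M[R]_n) (b1 b2 d : 'cV[R]_n) (c1 c2 : R)
    (symA1 : A1^T = A1) (symA2 : A2^T = A2) (symB : B^T = B)
    (hinf : (ereal_inf [set (quadfun0 B d x)%:E | x in [set: 'cV[R]_n]] < 0)%E)
    (hsup : (0 < ereal_sup [set (quadfun0 B d x)%:E | x in [set: 'cV[R]_n]])%E)
    (hzeta : exists zeta : 'cV[R]_n, quadfun0 B d zeta = 0 /\
       forall x : 'cV[R]_n, qform B x = 0 -> dotp (B *m zeta + d) x = 0)
    (lambda : R) :
  (~ exists x : 'cV[R]_n,
       quadfun A1 b1 c1 x - lambda * quadfun A2 b2 c2 x < 0 /\
       quadfun0 B d x = 0)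
  <->
  (exists mu : R, forall x : 'cV[R]_n,
       0 <= quadfun A1 b1 c1 x - lambda * quadfun A2 b2 c2 x
            + mu * quadfun0 B d x).
Proof.
split=> [nosol|[mu ge0] [x [flt0 h0]]]; last first.
  by have := ge0 x; rewrite h0 mulr0 addr0 leNgt flt0.
pose A := A1 - lambda *: A2; pose b := b1 - lambda *: b2.
pose c := c1 - lambda * c2.
have symA : A^T = A by rewrite /A linearB /= linearZ /= symA1 symA2.
have f0 x : quadfun B d 0 x = 0 -> 0 <= quadfun A b c x.
  move=> h0; rewrite leNgt; apply/negP => flt0; apply: nosol; exists x.
  by rewrite quadfunB quadfun0E.
have [zeta [hz hzB]] := hzeta; rewrite quadfun0E in hz.
have [|||mu ge0] := @finsler R _ (homog A b c) (homog B d 0)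
    (homog_quadratic _ _ symA) (homog_quadratic _ _ symB).
- move=> [x t]; have [->|t0] := eqVneq t 0.
    rewrite /homog /= !mul0r expr0n /= !mulr0 !addr0 => Bx0.
    apply: (@quadratic_ge0_lead _ (quadfun A b c zeta)
      (2 * dotp (A *m zeta + b) x)) => s.
    (* All three coefficients of h along the line vanish: the constant one as [zeta] is a zero, the
       linear one by [hzB], the leading one by [Bx0]. *)
    rewrite -quadfun_line //; apply: f0.
    by rewrite quadfun_line // hz Bx0 (hzB _ Bx0) !mulr0 !addr0.
  rewrite !homog_scale // => /eqP; rewrite mulf_eq0 sqrf_eq0 (negbTE t0) /=.
  by move=> /eqP /f0 f0x; rewrite mulr_ge0 ?sqr_ge0.
(* A positive supremum and a negative infimum are witnessed by points of each sign, lifted to height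
   [t = 1]. *)
- have [_ [x _ <-]] := ereal_sup_gt hsup.
  by rewrite lte_fin quadfun0E => hx; exists (x, 1); rewrite homog1.
- have [_ [x _ <-]] := ereal_inf_lt hinf.
  by rewrite lte_fin quadfun0E => hx; exists (x, 1); rewrite homog1.
exists mu => x; have := ge0 (x, 1).
by rewrite !homog1 quadfunB quadfun0E.
Qed.
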